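(* Let $p\ge 1$ and let $A \in \mathbb{R}^{m \times n}$ be a $(k, D)$-$\ell_p$-RIP matrix with $k\ge 1$, with rows $A_{1*}, \dots, A_{m*}$. If $1 \leq p < 2$, then $$D^p \left(\frac{n}{k}\right)^{p(\frac{1}{p} - \frac{1}{2})} \sum_{i = 1}^m \|A_{i*}\|_2^{p} \geq \sum_{i = 1}^m \|A_{i*}\|_p^p,$$ and if $p > 2$, then $$\sum_{i = 1}^m \|A_{i*}\|_2^{p} \leq D^p \left(\frac{n}{k}\right)^{p(\frac{1}{2} - \frac{1}{p} )}\sum_{i = 1}^m \|A_{i*}\|_p^p.$$
   Context: For $p\ge1$, a matrix $A \in \mathbb{R}^{m \times n}$ is $(k, D)$-$\ell_p$-RIP if there exists $K > 0$ such that for every $k$-sparse $x \in \mathbb{R}^n$ (at most $k$ nonzero entries), $K\|x\|_p \leq \|Ax\|_p \leq D K\|x\|_p$.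
   Formalization: The formal theorem additionally assumes k ≤ n; without it the claim fails, e.g. for n = m = 1, A = (1), k = 2, D = 1, p = 1, where it would say (1/2)^{1/2} ≥ 1. *)

(* Defs.v *)
From HB Require Import structures.
From mathcomp Require Import all_boot all_order all_algebra.
From mathcomp Require Import all_classical all_reals all_analysis.

Set Implicit Arguments.
Unset Strict Implicit.
Unset Printing Implicit Defensive.

Import Order.TTheory GRing.Theory Num.Theory.
Local Open Scope ring_scope.

Definition lpnorm (R : realType) (n : nat) (p : R) (x : 'cV[R]_n) : R :=
  (\sum_(i < n) `|x i 0| `^ p) `^ p^-1.

Definition sparse (R : realType) (n : nat) (k : nat) (x : 'cV[R]_n) : Prop :=
  (#|[pred i : 'I_n | (x i 0 != 0)%R]| <= k)%N.

Definition lp_RIP (R : realType) (m n : nat) (k : nat) (D p : R)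
    (A : 'M[R]_(m, n)) : Prop :=
  exists K : R, 0 < K /\
    forall x : 'cV[R]_n, sparse k x ->
      K * lpnorm p x <= lpnorm p (A *m x) /\
      lpnorm p (A *m x) <= D * K * lpnorm p x.

(* Main.v *)
Require Import Defs.
From HB Require Import structures.
From mathcomp Require Import all_boot all_order all_algebra.
From mathcomp Require Import all_classical all_reals all_analysis.
From mathcomp Require Import ring lra.

Set Implicit Arguments.
Unset Strict Implicit.
Unset Printing Implicit Defensive.

Import Order.TTheory GRing.Theory Num.Theory.
Local Open Scope ring_scope.

(** Evaluate [A] on the [k]-sparse vectors with random signs on a random cyclic
    window of [k] coordinates.  This family is isotropic: its second moment
    matrix is [(k / n) I], so the power mean inequality compares the average of
    [||A x||_p^p] with [(k / n)^(p / 2) * \sum_i ||A_i||_2^p].  The restricted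
    isometry property bounds that average by multiples of [k], and applied to
    the basis vectors it bounds [\sum_i ||A_i||_p^p], which is also the sum over
    the columns of [A], by multiples of [n]. *)

Lemma power_mean (R : realType) (W : finType) (q M : R) (y : W -> R) :
  1 < q -> 0 <= M -> (forall w, 0 <= y w) ->
  \sum_w y w = #|W|%:R * M -> #|W|%:R * M `^ q <= \sum_w y w `^ q.
Proof.
move=> q1 M0 y0 sumy.
have q0 : 0 < q by lra.
have q10 : 0 < q - 1 by lra.
have qN0 : q != 0 by rewrite gt_eqF.
have q1N0 : q - 1 != 0 by rewrite gt_eqF.
(* Young's inequality is here the tangent line to [y `^ q] at [y = M]. *)
have young w : y w * M `^ (q - 1) <= y w `^ q / q + M `^ q / (q / (q - 1)).
  have -> : M `^ q = (M `^ (q - 1)) `^ (q / (q - 1)).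
    by rewrite -powRrM; congr (_ `^ _); field.
  apply: conjugate_powR => //; first exact: powR_ge0.
    by rewrite divr_gt0.
  by field; rewrite qN0 q1N0.
have := ler_sum (index_enum W) (fun w (_ : xpredT w) => young w).
rewrite -mulr_suml sumy -mulrA mulr_powRB1 // big_split /= -mulr_suml.
rewrite sumr_const -[_ / _ *+ _]mulr_natl.
set S := \sum_w _; set T := _ `^ _; set N := _%:R.
(* Summed over [W], Young's inequality has [N * T] on the left, since [M] is the mean of [y];
   clearing [q] leaves [N * T <= S]. *)
have -> : S / q + N * (T / (q / (q - 1))) = (S + N * T * (q - 1)) / q.
  by field; rewrite qN0 q1N0.
by rewrite ler_pdivlMr //; lra.
Qed.

Lemma lpnorm_powR (R : realType) (n : nat) (p : R) (x : 'cV[R]_n) :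
  0 < p -> lpnorm p x `^ p = \sum_(i < n) `|x i 0| `^ p.
Proof.
move=> p0; rewrite /lpnorm -powRrM mulVf ?gt_eqF// powRr1 //.
by apply: sumr_ge0 => i _; exact: powR_ge0.
Qed.

Lemma lpnorm_ge0 (R : realType) (n : nat) (p : R) (x : 'cV[R]_n) :
  0 <= lpnorm p x.
Proof. exact: powR_ge0. Qed.

Lemma lpnorm_delta (R : realType) (n : nat) (p : R) (j : 'I_n) :
  p != 0 -> lpnorm p (delta_mx j 0 : 'cV[R]_n) = 1.
Proof.
move=> p0; rewrite /lpnorm (bigD1 j) //= big1 => [|i ij].
  by rewrite mxE !eqxx normr1 powR1 addr0 powR1.
by rewrite mxE (negbTE ij) normr0 powR0.
Qed.

Lemma sparse_delta (R : realType) (n k : nat) (j : 'I_n) :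
  (0 < k)%N -> sparse k (delta_mx j 0 : 'cV[R]_n).
Proof.
move=> k0; rewrite /sparse; apply: leq_trans k0.
rewrite -[X in (_ <= X)%N](card1 j); apply: subset_leq_card.
apply/fintype.subsetP => i.
by rewrite !inE mxE eqxx andbT; case: (i == j) => //; rewrite eqxx.
Qed.

Section IsotropicFamily.
Variables (R : realType) (n : nat) (W : finType) (c : R) (X : W -> 'cV[R]_n).
Hypotheses (W_gt0 : (0 < #|W|)%N) (c_ge0 : 0 <= c).
Hypothesis isotropic : forall j l,
  \sum_w X w j 0 * X w l 0 = (j == l)%:R * (#|W|%:R * c).
Variable a : 'cV[R]_n.

Let inner w := \sum_(j < n) a j 0 * X w j 0.

(** Expanding the square gives a double sum over pairs of coordinates, of which isotropy keeps only
    the diagonal. *)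
Lemma isotropic_second_moment :
  \sum_w `|inner w| `^ 2 = #|W|%:R * (c * \sum_(j < n) `|a j 0| `^ 2).
Proof.
under eq_bigr => w _ do rewrite powR_mulrn // real_normK ?num_real //
  expr2 /inner big_distrlr /=.
rewrite exchange_big /= !mulr_sumr; apply: eq_bigr => j _.
rewrite exchange_big /= (bigD1 j) //= [X in _ + X]big1 => [|l lj].
  rewrite addr0 powR_mulrn // real_normK ?num_real //.
  under eq_bigr do rewrite mulrACA.
  rewrite -mulr_sumr isotropic eqxx mul1r.
  by rewrite mulrC expr2 !mulrA.
under eq_bigr do rewrite mulrACA.
by rewrite -mulr_sumr isotropic eq_sym (negbTE lj) mul0r mulr0.
Qed.

Let sumsq_ge0 : 0 <= \sum_(j < n) `|a j 0| `^ 2.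
Proof. by apply: sumr_ge0 => j _; exact: powR_ge0. Qed.

Let lpnorm2_powR p :
  (c * \sum_(j < n) `|a j 0| `^ 2) `^ (p / 2) = c `^ (p / 2) * lpnorm 2 a `^ p.
Proof. by rewrite powRM // /lpnorm -[in RHS]powRrM [2^-1 * p]mulrC. Qed.

(** Power mean with exponent [p / 2 > 1], applied to the squares of the inner products, whose mean
    is known. *)
Lemma isotropic_moment_ge p : 2 < p ->
  #|W|%:R * (c `^ (p / 2) * lpnorm 2 a `^ p) <= \sum_w `|inner w| `^ p.
Proof.
move=> p2; rewrite -lpnorm2_powR.
have -> : \sum_w `|inner w| `^ p = \sum_w (`|inner w| `^ 2) `^ (p / 2).
  by apply: eq_bigr => w _; rewrite -powRrM; congr (_ `^ _); field.
apply: power_mean => [||w|]; [lra|exact: mulr_ge0|exact: powR_ge0|].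
exact: isotropic_second_moment.
Qed.

Lemma isotropic_moment_le p : 0 < p -> p < 2 ->
  \sum_w `|inner w| `^ p <= #|W|%:R * (c `^ (p / 2) * lpnorm 2 a `^ p).
Proof.
move=> p0 p2; rewrite -lpnorm2_powR.
have N0 : 0 < #|W|%:R :> R by rewrite ltr0n.
have NN0 : #|W|%:R != 0 :> R by rewrite gt_eqF.
have pN0 : p != 0 by rewrite gt_eqF.
pose M := (\sum_w `|inner w| `^ p) / #|W|%:R.
have sumM : \sum_w `|inner w| `^ p = #|W|%:R * M by rewrite /M; field.
have M0 : 0 <= M.
  by apply: divr_ge0 => //; apply: sumr_ge0 => w _; exact: powR_ge0.
have q1 : 1 < 2 / p by rewrite ltr_pdivlMr //; lra.
have := power_mean q1 M0 (fun w => powR_ge0 _ _) sumM.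
have -> : \sum_w (`|inner w| `^ p) `^ (2 / p) = \sum_w `|inner w| `^ 2.
  by apply: eq_bigr => w _; rewrite -powRrM; congr (_ `^ _); field.
rewrite isotropic_second_moment ler_pM2l // => le_M.
rewrite sumM ler_pM2l //.
have -> : M = (M `^ (2 / p)) `^ (p / 2).
  rewrite -powRrM; have -> : 2 / p * (p / 2) = 1 by field.
  by rewrite powRr1.
apply: ge0_ler_powR; rewrite ?nnegrE ?powR_ge0 ?mulr_ge0 //; lra.
Qed.

End IsotropicFamily.

Section SignedWindow.
Variables (R : realType) (n k : nat).
Hypothesis k_le : (k <= n.+1)%N.

(** [w.1] is the start of the window and [w.2] gives the signs. Subtraction in ['I_n.+1] is modulo
    [n.+1], so the window wraps around. *)
Definition signed_window (w : 'I_n.+1 * {ffun 'I_n.+1 -> bool}) : 'cV[R]_n.+1 :=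
  \col_j ((-1) ^+ w.2 j * ((j - w.1)%R < k)%N%:R).

Lemma card_window (t : 'I_n.+1) : #|[pred j : 'I_n.+1 | ((j - t)%R < k)%N]| = k.
Proof.
rewrite -sum1_card (reindex_inj (addIr t)).
rewrite (eq_bigl (fun j : 'I_n.+1 => (j < k)%N)) => [|j]; last first.
  by rewrite inE addrK.
by rewrite -(big_ord_widen _ (fun=> 1%N)) // sum1_card card_ord.
Qed.

Lemma sum_window (t : 'I_n.+1) :
  \sum_(j < n.+1) ((j - t)%R < k)%N%:R = k%:R :> R.
Proof.
rewrite -{2}(card_window t) -sum1_card natr_sum [RHS]big_mkcond /=.
by apply: eq_bigr => j _; rewrite inE; case: ifP.
Qed.

Lemma signed_window_sparse w : sparse k (signed_window w).
Proof.
rewrite /sparse -[X in (_ <= X)%N](card_window w.1); apply: subset_leq_card.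
apply/fintype.subsetP => j; rewrite !inE mxE.
by case: ltnP => //; rewrite mulr0 eqxx.
Qed.

Lemma signed_window_lpnorm p w :
  0 < p -> lpnorm p (signed_window w) `^ p = k%:R.
Proof.
move=> p0; rewrite lpnorm_powR // -(sum_window w.1); apply: eq_bigr => j _.
rewrite mxE normrM normrX normrN1 expr1n mul1r.
by case: ltnP; rewrite ?normr1 ?powR1 ?normr0 ?powR0 // gt_eqF.
Qed.

(** Off the diagonal the independent signs cancel. On it the squared signs are 1, and [j] lies in
    the window for [k] of the [n.+1] starts. *)
Lemma signed_window_isotropic j l :
  \sum_w signed_window w j 0 * signed_window w l 0 =
  (j == l)%:R * (#|{: 'I_n.+1 * {ffun 'I_n.+1 -> bool}}|%:R * (k%:R / n.+1%:R)).
Proof.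
have [<-|jl] := eqVneq j l; last first.
  rewrite mul0r.
  (* Flipping the sign at [j] negates the sum. *)
  pose flip (e : {ffun 'I_n.+1 -> bool}) : {ffun 'I_n.+1 -> bool} :=
    [ffun i => e i (+) (i == j)].
  have flipK : involutive (fun w : 'I_n.+1 * {ffun 'I_n.+1 -> bool} =>
      (w.1, flip w.2)).
    by case=> t e; congr pair; apply/ffunP => i; rewrite !ffunE addbK.
  set S := \sum_w _; suff : S = - S by lra.
  rewrite {1}/S (reindex_inj (inv_inj flipK)) /= -sumrN; apply: eq_bigr => w _.
  rewrite !mxE /= !ffunE eqxx eq_sym (negbTE jl) addbF addbT signrN; ring.
rewrite mul1r card_prod card_ord natrM.
transitivity (\sum_(t < n.+1) \sum_(e : {ffun 'I_n.+1 -> bool})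
    ((j - t)%R < k)%N%:R : R).
  rewrite pair_big /=; apply: eq_bigr => w _.
  by rewrite mxE mulrACA -expr2 sqrr_sign mul1r -natrM mulnb andbb.
under eq_bigr do rewrite sumr_const -[_ *+ #|_|]mulr_natl.
(* Replacing the start [t] by the offset [j - t] turns the sum into a count of the offsets below
   [k]. *)
rewrite -mulr_sumr (reindex_inj (subrI j)).
under eq_bigr do rewrite subKr.
have -> : \sum_(i < n.+1) (i < k)%N%:R = k%:R :> R.
  by rewrite -(sum_window 0); apply: eq_bigr => i _; rewrite subr0.
by rewrite [n.+1%:R * _]mulrC -mulrA [n.+1%:R * _]mulrC divfK ?pnatr_eq0.
Qed.

End SignedWindow.

(** Both sides add the [p]-th powers of the moduli of all entries of [A], by rows and by columns. *)
Lemma row_powR_sum_cols (R : realType) (m n : nat) (p : R) (A : 'M[R]_(m, n)) :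
  0 < p ->
  \sum_(i < m) lpnorm p (row i A)^T `^ p =
  \sum_(j < n) lpnorm p (A *m delta_mx j 0) `^ p.
Proof.
move=> p0; under eq_bigr do rewrite lpnorm_powR //.
rewrite exchange_big /=; apply: eq_bigr => j _.
rewrite lpnorm_powR //; apply: eq_bigr => i _.
by rewrite -colE !mxE.
Qed.

Theorem theorem5 (R : realType) (m n k : nat) (D p : R) (A : 'M[R]_(m, n))
    (hp : 1 <= p) (hk : (1 <= k)%N) (hkn : (k <= n)%N)
    (hA : lp_RIP k D p A) :
  (1 <= p < 2 ->
     D `^ p * (n%:R / k%:R) `^ (p * (1 / p - 1 / 2))
       * (\sum_(i < m) lpnorm 2 (row i A)^T `^ p)
     >= \sum_(i < m) lpnorm p (row i A)^T `^ p) /\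
  (2 < p ->
     \sum_(i < m) lpnorm 2 (row i A)^T `^ p
     <= D `^ p * (n%:R / k%:R) `^ (p * (1 / 2 - 1 / p))
       * (\sum_(i < m) lpnorm p (row i A)^T `^ p)).
Proof.
case: n => [|n] in A hkn hA *; first by rewrite leqNgt hk in hkn.
case: hA => K [K0 rip].
have p0 : 0 < p by lra.
have pN0 : p != 0 by rewrite gt_eqF.
(* On a basis vector the two bounds give [K <= D * K], hence even [1 <= D]. *)
have D0 : 0 <= D.
  have [lo hi] := rip _ (sparse_delta R ord0 hk).
  have := le_trans lo hi; rewrite lpnorm_delta // !mulr1.
  by rewrite -ler_pdivrMr // divff ?gt_eqF // => /(le_trans ler01).
have ripp x : sparse k x ->
    K `^ p * lpnorm p x `^ p <= lpnorm p (A *m x) `^ p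
      <= D `^ p * K `^ p * lpnorm p x `^ p.
  have pw := ge0_ler_powR (ltW p0).
  move=> /rip[lo hi]; rewrite -!powRM ?lpnorm_ge0 ?mulr_ge0 ?(ltW K0) //.
  by apply/andP; split; apply: pw;
    rewrite // nnegrE ?mulr_ge0 ?lpnorm_ge0 ?(ltW K0).
pose Sp := \sum_(i < m) lpnorm p (row i A)^T `^ p.
pose S2 := \sum_(i < m) lpnorm 2 (row i A)^T `^ p.
(* Each of the [n.+1] columns is the image of a basis vector, so its norm lies between [K] and
   [D * K]. *)
have Sp_ge : n.+1%:R * K `^ p <= Sp.
  rewrite /Sp row_powR_sum_cols // mulr_natl -[n.+1 in X in X <= _]card_ord.
  rewrite -sumr_const; apply: ler_sum => j _.
  have /andP[+ _] := ripp _ (sparse_delta R j hk).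
  by rewrite lpnorm_delta // powR1 mulr1.
have Sp_le : Sp <= n.+1%:R * (D `^ p * K `^ p).
  rewrite /Sp row_powR_sum_cols // mulr_natl -[n.+1 in X in _ <= X]card_ord.
  rewrite -sumr_const; apply: ler_sum => j _.
  have /andP[_] := ripp _ (sparse_delta R j hk).
  by rewrite lpnorm_delta // powR1 mulr1.
pose W : finType := ('I_n.+1 * {ffun 'I_n.+1 -> bool})%type.
pose X : W -> 'cV[R]_n.+1 := @signed_window R n k.
have W0 : (0 < #|W|)%N.
  by apply/card_gt0P; exists (0, [ffun=> true]).
have N0 : 0 < #|W|%:R :> R by rewrite ltr0n.
have n0 : 0 < n.+1%:R :> R by rewrite ltr0n.
have k0 : 0 < k%:R :> R by rewrite ltr0n.
pose c : R := k%:R / n.+1%:R.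
have c0 : 0 <= c by rewrite divr_ge0.
have X_iso : forall j l, \sum_w X w j 0 * X w l 0 = (j == l)%:R * (#|W|%:R * c).
  exact: signed_window_isotropic.
(* The coordinates of [A *m X w] are inner products with the rows of [A], so the moment bounds apply
   row by row. *)
have rowsE : \sum_w lpnorm p (A *m X w) `^ p =
    \sum_(i < m) \sum_w `|\sum_(j < n.+1) (row i A)^T j 0 * X w j 0| `^ p.
  under eq_bigr do rewrite lpnorm_powR //.
  rewrite exchange_big /=; apply: eq_bigr => i _; apply: eq_bigr => w _.
  by rewrite mxE; congr (`| _ | `^ _); apply: eq_bigr => j _; rewrite !mxE.
have avg_ge : #|W|%:R * (K `^ p * k%:R) <= \sum_w lpnorm p (A *m X w) `^ p.
  rewrite mulr_natl -sumr_const; apply: ler_sum => w _.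
  have /andP[+ _] := ripp _ (signed_window_sparse R hkn w).
  by rewrite signed_window_lpnorm.
have avg_le : \sum_w lpnorm p (A *m X w) `^ p
    <= #|W|%:R * (D `^ p * K `^ p * k%:R).
  rewrite mulr_natl -sumr_const; apply: ler_sum => w _.
  have /andP[_] := ripp _ (signed_window_sparse R hkn w).
  by rewrite signed_window_lpnorm.
pose r : R := n.+1%:R / k%:R.
have r0 : 0 < r by rewrite divr_gt0.
have rN0 : r != 0 by rewrite gt_eqF.
have cr q : c `^ q = (r `^ q)^-1.
  by rewrite -powRN -[- q]mulN1r powRrM powR_inv1 ?(ltW r0) // invf_div.
have rp0 : 0 < r `^ (p / 2) by rewrite powR_gt0.
have nE : n.+1%:R = r * k%:R by rewrite /r divfK ?gt_eqF.
have Dp0 : 0 <= D `^ p by exact: powR_ge0.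
split=> [/andP[_ p2]|p2].
- change (Sp <= D `^ p * r `^ (p * (1 / p - 1 / 2)) * S2).
  have -> : p * (1 / p - 1 / 2) = 1 - p / 2 by field.
  rewrite powRB ?rN0 ?implybT // powRr1 ?(ltW r0) //.
  (* The lower isometry bound on the average meets the upper moment bound. *)
  have avg : K `^ p * k%:R <= (r `^ (p / 2))^-1 * S2.
    rewrite -(ler_pM2l N0) (le_trans avg_ge) // rowsE -cr !mulr_sumr.
    by apply: ler_sum => i _; exact: isotropic_moment_le.
  apply: le_trans Sp_le _; rewrite nE.
  have -> : r * k%:R * (D `^ p * K `^ p) = D `^ p * r * (K `^ p * k%:R) by ring.
  have -> : D `^ p * (r / r `^ (p / 2)) * S2 =
    D `^ p * r * ((r `^ (p / 2))^-1 * S2) by ring.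
  by apply: ler_wpM2l => //; rewrite mulr_ge0 // ltW.
- change (S2 <= D `^ p * r `^ (p * (1 / 2 - 1 / p)) * Sp).
  have -> : p * (1 / 2 - 1 / p) = p / 2 - 1 by field.
  rewrite powRB ?rN0 ?implybT // powRr1 ?(ltW r0) //.
  (* Now the lower moment bound meets the upper isometry bound. *)
  have avg : (r `^ (p / 2))^-1 * S2 <= D `^ p * K `^ p * k%:R.
    rewrite -(ler_pM2l N0) (le_trans _ avg_le) // rowsE -cr !mulr_sumr.
    by apply: ler_sum => i _; exact: isotropic_moment_ge.
  rewrite mulrC ler_pdivrMr // in avg.
  apply: le_trans avg _.
  have -> : D `^ p * (r `^ (p / 2) / r) * Sp =
    D `^ p * r `^ (p / 2) * (Sp / r) by ring.
  have -> : D `^ p * K `^ p * k%:R * r `^ (p / 2) =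
    D `^ p * r `^ (p / 2) * (K `^ p * k%:R) by ring.
  apply: ler_wpM2l; first by rewrite mulr_ge0 // ltW.
  rewrite ler_pdivlMr //; apply: le_trans Sp_ge; rewrite nE.
  by rewrite le_eqVlt; apply/orP; left; apply/eqP; ring.
Qed.
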